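(* Let $n\ge 2$ and let $C=\{c\in\{0,1\}^n : c_1+\cdots+c_n \equiv 0 \pmod 2\}$ be the (even) parity check code of length $n$, which has dimension $k=n-1$ and minimum Hamming distance $d_{\min}=2$. Suppose a codeword of $C$ is transmitted with BPSK modulation over the ideally interleaved (independent) Rayleigh fading channel with average SNR per code bit $\bar\gamma_c$ and with the fading coefficients known at the receiver, and is decoded by the flip decoder (make bitwise hard decisions; if the parity check fails, flip the bit whose fading coefficient has the smallest absolute value; output the resulting word). Let $P_{FD}(\bar\gamma_c)$ denote the probability that the output of the flip decoder differs from the transmitted codeword. Then the flip decoder has diversity order $d_{\min}=2$, that is, $$\lim_{\bar\gamma_c\to\infty}\frac{-\log P_{FD}(\bar\gamma_c)}{\log\bar\gamma_c}=2 .$$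
   Context: Channel model. A codeword $c=(c_1,\dots,c_n)\in C$ is mapped to the bipolar sequence $x=(x_1,\dots,x_n)$ with $x_i=2c_i-1\in\{-1,1\}$. The received signal is $r_i=h_ix_i+w_i$, $1\le i\le n$. Here $h_1,\dots,h_n\ge 0$ are i.i.d. Rayleigh random variables normalized so that $\mathbb{E}[h_i^2]=1$ (equivalently, the $h_i^2$ are i.i.d. exponential with mean $1$). The $w_i$ are i.i.d. circularly symmetric complex Gaussian random variables with mean zero and variance $N_0$ (so $\operatorname{Re} w_i$ is real Gaussian with mean $0$ and variance $N_0/2$), independent of the $h_i$. The average SNR per code bit is $\bar\gamma_c=1/N_0$, and the instantaneous SNR of bit $i$ is $\gamma_i=h_i^2\bar\gamma_c$. Consequently, conditionally on $h_i$, the bitwise hard decision on bit $i$ is wrong with probability $Q(\sqrt{2\gamma_i})$, independently over $i$, where $Q(u)=\frac{1}{\sqrt{2\pi}}\int_u^\infty e^{-s^2/2}\,ds$. Flip decoder. The receiver knows $h_1,\dots,h_n$. (1) Form the hard decisions $\hat r_i\in\{0,1\}$ by $\hat r_i=1$ if $\operatorname{Re}(r_i)>0$ and $\hat r_i=0$ otherwise. (2) Let $i^*$ be an index minimizing $|h_i|$ (ties have probability zero). (3) If $\hat r_1+\cdots+\hat r_{n-1}\not\equiv \hat r_n \pmod 2$, replace $\hat r_{i^*}$ by $1-\hat r_{i^*}$; otherwise leave $\hat r$ unchanged. (4) Output $\hat r$. Error probability and diversity order. The error probability is taken over both the fading and the noise, and by symmetry it does not depend on which codeword is transmitted. The diversity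 order of a decoder with error probability $P(\bar\gamma_c)$ is $D=\lim_{\bar\gamma_c\to\infty}\frac{-\log P(\bar\gamma_c)}{\log\bar\gamma_c}$, with $n$ fixed. *)

(* Defs.v *)
From HB Require Import structures.
From mathcomp Require Import all_boot all_order all_algebra.
From mathcomp Require Import complex.
From mathcomp Require Import all_classical all_reals all_analysis.

Set Implicit Arguments.
Unset Strict Implicit.
Unset Printing Implicit Defensive.

Import Order.TTheory GRing.Theory Num.Theory.
Import numFieldNormedType.Exports.

Local Open Scope classical_set_scope.
Local Open Scope ring_scope.

Section Codes.
Variable n : nat.

Definition hamming_distance (x y : 'rV['F_2]_n) : nat :=
  #|[set i | x 0 i != y 0 i]%SET|.

(* The neutral element [n] is harmless for a code with at least two words,
   because distances never exceed [n]. *)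
Definition min_distance (C : {vspace 'rV['F_2]_n}) : nat :=
  \big[minn/n]_(p : 'rV['F_2]_n * 'rV['F_2]_n |
      [&& p.1 \in C, p.2 \in C & p.1 != p.2]) hamming_distance p.1 p.2.

Definition parity (c : 'rV['F_2]_n) : ('F_2)^o := \sum_(i < n) c 0 i.

Lemma parity_is_linear : linear parity.
Proof.
move=> a u v; rewrite /parity scaler_sumr -big_split /=.
by apply: eq_bigr => i _; rewrite !mxE.
Qed.

HB.instance Definition _ := GRing.isLinear.Build 'F_2 'rV['F_2]_n ('F_2)^o _
  parity parity_is_linear.

Definition parity_code : {vspace 'rV['F_2]_n} := lker (linfun parity).

Lemma mem_parity_code (c : 'rV['F_2]_n) :
  (c \in parity_code) = (\sum_(i < n) c 0 i == 0).
Proof. by rewrite memv_ker lfunE. Qed.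

End Codes.

Section Decoder.
Variables (R : realType) (n : nat).

(* [b : nat] is the representative of [b] in {0, 1}. *)
Definition bpsk (b : 'F_2) : R := 2 * (b : nat)%:R - 1.

Definition received (h : 'I_n -> R) (w : 'I_n -> R[i]) (c : 'rV['F_2]_n)
  (i : 'I_n) : R[i] := real_complex R (h i * bpsk (c 0 i)) + w i.

Definition hard_decision (r : 'I_n -> R[i]) : 'rV['F_2]_n :=
  \row_i (if 0 < complex.Re (r i) then 1 else 0).

(* Ties are resolved by the choice operator; the result is [None] only when
   [n = 0]. *)
Definition weakest (h : 'I_n -> R) : option 'I_n :=
  [pick i | [forall j, `|h i| <= `|h j|]].

(* The sum of all the bits but the last one is compared with the last bit;
   equality in 'F_2 is congruence modulo 2. *)
Definition parity_check_fails (b : 'rV['F_2]_n) : bool :=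
  \sum_(i < n | i != n.-1 :> nat) b 0 i != \sum_(i < n | i == n.-1 :> nat) b 0 i.

Definition flip_decoder (h : 'I_n -> R) (r : 'I_n -> R[i]) : 'rV['F_2]_n :=
  let b := hard_decision r in
  if parity_check_fails b then
    \row_i (if weakest h == Some i then 1 - b 0 i else b 0 i)
  else b.

End Decoder.

Section Probability.
Variables (d : measure_display) (T : measurableType d) (R : realType).
Variable P : probability T R.

Definition mutually_independent (I : finType) (F : I -> set_system T) : Prop :=
  forall (J : {set I}) (A : I -> set T), (forall i, i \in J -> F i (A i)) ->
    P (\bigcap_(i in [set` J]) A i) = (\prod_(i in J) P (A i))%E.

Definition generated_by (d' : measure_display) (U : measurableType d')
  (X : T -> U) : set_system T := preimage_set_system setT X measurable.

Definition rayleigh_pdf (s x : R) : R :=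
  if 0 <= x then x / s ^+ 2 * expR (- (x ^+ 2 / (2 * s ^+ 2))) else 0.

Definition rayleigh_distributed (s : R) (X : {RV P >-> R}) : Prop :=
  forall A : set R, measurable A ->
    distribution P X A =
    (\int[lebesgue_measure]_(x in A) (rayleigh_pdf s x)%:E)%E.

Definition real_pair (Z : T -> R[i]) (t : T) : R * R :=
  (complex.Re (Z t), complex.Im (Z t)).

(* Circularly symmetric complex Gaussian variable of mean 0 and variance
   E|Z|^2 = v: the real and imaginary parts are independent and centred
   Gaussian, each of variance v / 2. *)
Definition circular_gaussian (v : R) (Z : T -> R[i]) : Prop :=
  measurable_fun setT (real_pair Z) /\
  forall A : set (R * R), measurable A ->
    P (real_pair Z @^-1` A) =
    (normal_prob 0 (Num.sqrt (v / 2)) \x normal_prob 0 (Num.sqrt (v / 2)))%E A.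

(* Fading [h] and noise [w] of the interleaved Rayleigh channel with noise
   variance [N0].  The index [inl i] stands for [h i] and [inr i] for [w i]:
   the 2n variables are mutually independent.  The normalization forces the
   scale [s] of the Rayleigh law to be 1 / sqrt 2. *)
Record rayleigh_channel (n : nat) (s N0 : R)
    (h : 'I_n -> {RV P >-> R}) (w : 'I_n -> T -> R[i]) : Prop := {
  fading_ge0 : forall i t, 0 <= h i t;
  fading_law : forall i, rayleigh_distributed s (h i);
  fading_normalized : forall i, ('E_P[fun t => ((h i t) ^+ 2)%R] = 1)%E;
  noise_law : forall i, circular_gaussian N0 (w i);
  channel_independent : mutually_independent
    (fun k : 'I_n + 'I_n => match k with
                            | inl i => generated_by (h i)
                            | inr i => generated_by (real_pair (w i))
                            end) }.

Definition flip_error_probability (n : nat) (h : 'I_n -> {RV P >-> R})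
    (w : 'I_n -> T -> R[i]) (c : 'rV['F_2]_n) : R :=
  fine (P [set t | flip_decoder (fun i => h i t)
                     (received (fun i => h i t) (fun i => w i t) c) <> c]).

End Probability.

Definition has_diversity_order (R : realType) (Pe : R -> R) (D : R) : Prop :=
  (- ln (Pe snr) / ln snr) @[snr --> +oo] --> D.

(* Main.v *)
(* The decoder errs if and only if two hard decisions are wrong or a single one
   is wrong away from the weakest position.  So an error gives i <> j with
   decision i wrong and either decision j wrong or |h_j| <= |h_i|; as a wrong
   decision at i forces h_i <= |Re w_i|, for every tau either some |Re w_i| is
   at least tau or two fading coefficients are at most tau.  With
   tau^2 = 4 ln g / g at SNR g, the first event has probability O(g^-2) by the
   Gaussian tail, the second O((ln g / g)^2) because P(h <= tau) <= (tau / s)^2.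
   Conversely, with probability of order g^-2 two fixed positions have fading
   at most g^(-1/2) and adverse noise of the same order, hence both decisions
   are wrong there.  The logarithmic factor does not affect the exponent 2. *)

Require Import Defs.
From mathcomp Require Import all_boot all_order all_algebra.
From mathcomp Require Import complex.
From mathcomp Require Import all_classical all_reals all_analysis.
From mathcomp Require Import measurable_realfun.
From mathcomp Require Import ring lra.

Import Order.TTheory GRing.Theory Num.Theory.
Import numFieldNormedType.Exports.

Set Implicit Arguments.
Unset Strict Implicit.
Unset Printing Implicit Defensive.

Local Open Scope ring_scope.

(** * The parity check code and the flip decoder *)

Lemma F2_neq (x y : 'F_2) : x != y -> x = 1 - y.
Proof. by case: x y => [[|[|//]] ?] [[|[|//]] ?] // _; apply/val_inj. Qed.

Lemma parity_split n (b : 'rV['F_2]_n) :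
  parity b = \sum_(i < n | i == n.-1 :> nat) b 0 i
             + \sum_(i < n | i != n.-1 :> nat) b 0 i.
Proof. by rewrite /parity (bigID (fun i : 'I_n => i == n.-1 :> nat)). Qed.

(** In characteristic 2, two elements differ exactly when their sum is nonzero, so the comparison
    made by the decoder is a test of membership in the code. *)
Lemma parity_check_failsE n (b : 'rV['F_2]_n) :
  parity_check_fails b = (parity b != 0).
Proof.
rewrite /parity_check_fails parity_split.
move: (\sum_(i < n | _ != _) _) (\sum_(i < n | _ == _) _) => x y.
by case: x y => [[|[|//]] ?] [[|[|//]] ?].
Qed.

(** One changed bit toggles the parity. This excludes codewords at distance one, and also a single
    wrong decision that passes the check. *)
Lemma parity_delta n (b c : 'rV['F_2]_n) i :
  b 0 i != c 0 i -> (forall j, j != i -> b 0 j = c 0 j) ->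
  parity b = 1 + parity c.
Proof.
move=> bci bcj; rewrite /parity (bigD1 i)//= [X in _ = 1 + X](bigD1 i)//= addrA.
congr (_ + _); last exact: eq_bigr.
by rewrite (F2_neq bci); case: (c 0 i) => [[|[|//]] ?]; apply/val_inj.
Qed.

Lemma hamming_distance_parity_code n (x y : 'rV['F_2]_n) :
  x \in parity_code n -> y \in parity_code n -> x != y ->
  (2 <= hamming_distance x y)%N.
Proof.
rewrite !mem_parity_code -!/(parity _) => /eqP px /eqP py xy.
rewrite /hamming_distance; set D := [set _ | _]%SET.
have [i iD] : exists i, i \in D.
  apply/existsP; apply: contraR xy; rewrite negb_exists => /forallP H.
  by apply/eqP/rowP => i; apply/eqP; have := H i; rewrite inE negbK.
rewrite (cardsD1 i) iD add1n ltnS card_gt0; apply/set0Pn.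
apply/existsP; apply: contraT; rewrite negb_exists => /forallP H.
have xyi : x 0 i != y 0 i by move: iD; rewrite inE.
suff /(parity_delta xyi)/eqP : forall j, j != i -> x 0 j = y 0 j.
  by rewrite px py addr0 eq_sym oner_eq0.
by move=> j ji; apply/eqP; have := H j; rewrite !inE ji /= negbK.
Qed.

Lemma bigminn_le (I : finType) m (Q : pred I) (F : I -> nat) i0 :
  Q i0 -> (\big[minn/m]_(i | Q i) F i <= F i0)%N.
Proof.
move=> Qi0; have := mem_index_enum i0.
elim: (index_enum I) => //= j e IH; rewrite inE big_cons.
move=> /predU1P[<-|/IH ji0]; first by rewrite Qi0 geq_minl.
by case: ifP => // _; rewrite geq_min ji0 orbT.
Qed.

Lemma min_distance_parity_code n :
  (2 <= n)%N -> min_distance (parity_code n) = 2%N.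
Proof.
case: n => [|[|n]]// _; apply/eqP; rewrite eqn_leq; apply/andP; split.
(* The word with ones exactly at the two ends; its distance to [0] attains the minimum. *)
- pose x : 'rV['F_2]_n.+2 := delta_mx 0 ord0 + delta_mx 0 ord_max.
  have xE i : x 0 i = (i == ord0)%:R + (i == ord_max)%:R.
    by rewrite !mxE !eqxx.
  have sum1 (j : 'I_n.+2) : \sum_i (i == j)%:R = 1 :> 'F_2.
    by rewrite (bigD1 j)//= eqxx big1 ?addr0// => i /negbTE ->.
  have D2 : hamming_distance x 0 = 2%N.
    transitivity (#|[set ord0; ord_max : 'I_n.+2]%SET|); last by rewrite cards2.
    apply: eq_card => i; rewrite !inE xE mxE. 
    by case: (eqVneq i ord0) => [->//|_]; case: (i == ord_max).
  have xC : x \in parity_code n.+2.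
    rewrite mem_parity_code (eq_bigr _ (fun i _ => xE i)) big_split /=.
    by rewrite !sum1; apply/eqP/val_inj.
  rewrite -D2; apply: (@bigminn_le _ _ _ _ (x, 0)); rewrite /= xC mem0v /=.
  apply/eqP => x0; move: D2; rewrite x0 /hamming_distance.
  by rewrite (_ : [set _ | _]%SET = finset.set0) ?cards0//; apply/setP => i; rewrite !inE eqxx.
(* The default value of the minimum is the length, itself at least 2, so the bound survives the
   induction. *)
- rewrite /min_distance; elim/big_ind : _ => //.
    by move=> a b ha hb; rewrite leq_min ha hb.
  by move=> [x y] /and3P[/= xC yC xy]; exact: hamming_distance_parity_code.
Qed.

(** Rank-nullity: the parity is onto ['F_2], since the multiples of the first unit vector already
    reach every value. *)
Lemma dim_parity_code n : (0 < n)%N -> \dim (parity_code n) = n.-1.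
Proof.
case: n => // n _.
have limT : limg (linfun (@parity n.+1)) = fullv.
  apply/eqP; rewrite eqEsubv subvf /=; apply/subvP => v _.
  have -> : v = linfun (@parity n.+1) (v *: delta_mx 0 ord0).
    rewrite lfunE /= /parity (bigD1 ord0)//= big1.
      by rewrite !mxE !eqxx mulr1 addr0.
    by move=> i /negbTE i0; rewrite !mxE i0 andbF mulr0.
  by rewrite memv_img ?memvf.
have := limg_ker_dim (linfun (@parity n.+1)) fullv.
rewrite limT capfv !dimvf (_ : dim ('F_2)^o = 1%N)//.
rewrite (_ : dim 'rV['F_2]_n.+1 = n.+1); last by rewrite /dim /= mul1n.
by rewrite addn1 => -[].
Qed.

(** * Error patterns that defeat the flip decoder *)

Section FlipDecoder.
Variables (R : realType) (n : nat).
Implicit Types (c b : 'rV['F_2]_n) (h : 'I_n -> R) (r : 'I_n -> R[i]).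

Lemma weakest_le h i j : weakest h = Some j -> `|h j| <= `|h i|.
Proof. by rewrite /weakest; case: pickP => // k /forallP hk [<-]. Qed.

Lemma weakest_neq_none h (i : 'I_n) : weakest h <> None.
Proof.
rewrite /weakest; case: pickP => // hN _.
have [j _ hj] : exists2 j, true & forall k, true -> `|h j| <= `|h k|.
  by case: (@Order.TotalTheory.arg_minP _ _ 'I_n i xpredT (fun j => `|h j|) isT) => j; exists j.
have: [forall k, `|h j| <= `|h k|] by apply/forallP => k; exact: hj.
by rewrite hN.
Qed.

(** Case analysis on the check. If it passes, a wrong decision cannot be alone, by parity. If it
    fails, a wrong decision away from the weakest position [j] forms the required pair with [j];
    otherwise [j] is the only error and the flip repairs it. *)
Lemma flip_decoder_neq_sub h r c : c \in parity_code n ->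
  flip_decoder h r <> c ->
  exists i j, [/\ i != j, hard_decision r 0 i != c 0 i &
    hard_decision r 0 j != c 0 j \/ `|h j| <= `|h i|].
Proof.
rewrite mem_parity_code -/(parity _) /flip_decoder parity_check_failsE => /eqP pc.
set b := hard_decision r.
have [[i bi]|H] := pselect (exists i, b 0 i != c 0 i); last first.
  have -> : b = c.
    by apply/rowP => i; apply/eqP; apply: contra_notT H => bi; exists i.
  by rewrite pc eqxx.
case: ifPn => [pb|/negPn/eqP pb] neq; last first.
  have [[j [ij bj]]|H] := pselect (exists j, i != j /\ b 0 j != c 0 j).
    by exists i, j; split=> //; left.
  suff /(parity_delta bi)/eqP : forall j, j != i -> b 0 j = c 0 j.
    by rewrite pb pc addr0 eq_sym oner_eq0.
  by move=> j ji; apply/eqP; apply: contra_notT H => bj; exists j; rewrite eq_sym.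
case wE : (weakest h) neq (@weakest_neq_none h i) => [j|//] neq _.
have [[k [kj bk]]|H] := pselect (exists k, k != j /\ b 0 k != c 0 k).
  by exists k, j; split => //; right; exact: weakest_le.
have bE k : k != j -> b 0 k = c 0 k.
  by move=> kj; apply/eqP; apply: contra_notT H => bk; exists k.
have ij : i = j by apply/eqP; apply: contraT => /bE /eqP; rewrite (negbTE bi).
exfalso; apply: neq; apply/rowP => k; rewrite mxE.
have [[jk]|jk] := eqVneq (Some j) (Some k).
  by rewrite -jk -ij (F2_neq bi) subKr.
by rewrite bE//; apply: contra_neq jk => ->.
Qed.

(** The flip changes at most one position, so two wrong decisions cannot both be repaired. *)
Lemma flip_decoder_neq h r c i j : i != j ->
  hard_decision r 0 i != c 0 i -> hard_decision r 0 j != c 0 j ->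
  flip_decoder h r <> c.
Proof.
move=> ij bi bj; rewrite /flip_decoder; case: ifP => _ bc; last first.
  by move: bi; rewrite bc eqxx.
have wE k : hard_decision r 0 k != c 0 k -> weakest h = Some k.
  move=> bk; apply/eqP; apply: contraNT bk => /negbTE wk.
  by rewrite -bc !mxE wk.
by have := wE _ bi; rewrite (wE _ bj) => -[ji]; rewrite ji eqxx in ij.
Qed.

(** The signal is [h i] times a sign, so the noise must outweigh it to turn the decision. The
    inequality is weak because a real part equal to zero is decided as 0, which is wrong for a
    transmitted 1. *)
Lemma hard_decision_neq_le h (w : 'I_n -> R[i]) c i :
  hard_decision (received h w c) 0 i != c 0 i -> h i <= `|complex.Re (w i)|.
Proof.
rewrite mxE /received [complex.Re (_ + _)]raddfD /= /bpsk.
have := ler_norm (complex.Re (w i)); have := ler_norm (- complex.Re (w i)).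
rewrite normrN; move: (complex.Re (w i)) => x.
by case: (c 0 i) => [[|[|//]] ?] /=; case: ifPn => //= + + + _; lra.
Qed.

(** The hypothesis compares the fading with the noise component opposed to the transmitted sign;
    strictness stays clear of the tie at zero. *)
Lemma hard_decision_neq h (w : 'I_n -> R[i]) c i :
  h i < - bpsk R (c 0 i) * complex.Re (w i) ->
  hard_decision (received h w c) 0 i != c 0 i.
Proof.
rewrite mxE /received [complex.Re (_ + _)]raddfD /= /bpsk.
move: (complex.Re (w i)) => x.
by case: (c 0 i) => [[|[|//]] ?] /=; case: ifPn => //= e1 e2; exfalso;
  move: e1 e2; lra.
Qed.

End FlipDecoder.

(** * Logarithmic asymptotics *)

Section Asymptotics.
Local Open Scope classical_set_scope.
Variable R : realType.

Lemma cvgy_ln : @ln R x @[x --> +oo] --> +oo.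
Proof.
apply/cvgryPge => A; near=> x.
have x0 : 0 < x by near: x; exact: nbhs_pinfty_gt.
by rewrite -(expRK A) ler_ln ?posrE ?expR_gt0//; near: x; exact: nbhs_pinfty_ge.
Unshelve. all: by end_near. Qed.

Lemma cvgy_invr_ln : (@ln R x)^-1 @[x --> +oo] --> (0 : R).
Proof.
apply/gtr0_cvgV0; last exact: cvgy_ln.
by near do (apply: ln_gt0); exact: nbhs_pinfty_gt.
Unshelve. all: by end_near. Qed.

(** Writing [ln x] as the square of its root gives [ln (ln x) <= 2 * Num.sqrt (ln x)], so the ratio
    is at most 2 over the root of [ln x]. *)
Lemma cvgy_lnln_div : ln (@ln R x) / ln x @[x --> +oo] --> (0 : R).
Proof.
apply: (@squeeze_cvgr _ _ _ _ (fun=> 0) (fun x => 2 * Num.sqrt (ln x)^-1)).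
- near=> x.
  have l1 : 1 <= ln x by near: x; move: cvgy_ln => /cvgryPge; exact.
  have l0 : 0 < ln x by apply: lt_le_trans l1.
  rewrite (divr_ge0 (ln_ge0 l1) (ltW l0))/=.
  rewrite ler_pdivrMr// -mulrA.
  have -> : Num.sqrt (ln x)^-1 * ln x = Num.sqrt (ln x).
    rewrite sqrtrV ?ltW// -{2}(sqr_sqrtr (ltW l0)) expr2 mulKf//.
    by rewrite gt_eqF// sqrtr_gt0.
  rewrite -[X in ln X](sqr_sqrtr (ltW l0)) lnXn ?sqrtr_gt0// mulr_natl.
  by rewrite lerMn2r ltW// ln_sublinear// sqrtr_gt0.
- exact: cvg_cst.
- rewrite -[X in _ --> X](mulr0 2); apply: cvgM; first exact: cvg_cst.
  rewrite -[X in _ --> X](sqrtr0 R).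
  by apply: (cvg_comp _ Num.sqrt cvgy_invr_ln); exact: sqrt_continuous.
Unshelve. all: by end_near. Qed.

(** After taking logarithms and dividing by [ln g], the constants contribute terms of order
    [1 / ln g] and the squared logarithm contributes [2 * (ln (ln g) / ln g)]; both vanish in the
    limit. *)
Lemma has_diversity_order2 (Pe : R -> R) (a b : R) : 0 < a -> 0 < b ->
  (\forall g \near +oo, a / g ^+ 2 <= Pe g <= b * ln g ^+ 2 / g ^+ 2) ->
  has_diversity_order Pe 2.
Proof.
move=> a0 b0 H; rewrite /has_diversity_order.
apply: (@squeeze_cvgr _ _ _ _
  (fun g => 2 - ln b * (ln g)^-1 - 2 * (ln (ln g) / ln g))
  (fun g => 2 - ln a * (ln g)^-1)).
- near=> g.
  have g1 : 1 < g by near: g; exact: nbhs_pinfty_gt.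
  have g0 : 0 < g by apply: lt_trans g1.
  have l0 : 0 < ln g by apply: ln_gt0.
  have g20 : 0 < g ^+ 2 by rewrite exprn_gt0.
  have /andP[aP Pb] : a / g ^+ 2 <= Pe g <= b * ln g ^+ 2 / g ^+ 2.
    by near: g.
  (* The lower bound also supplies positivity, on which the monotonicity of [ln] depends. *)
  have P0 : 0 < Pe g by apply: lt_le_trans aP; rewrite divr_gt0.
  have lb0 : 0 < b * ln g ^+ 2 by rewrite mulr_gt0 ?exprn_gt0.
  have La : ln a - 2 * ln g <= ln (Pe g).
    by rewrite mulr_natl -lnXn// -ln_div ?posrE// ler_ln ?posrE// divr_gt0.
  have Lb : ln (Pe g) <= ln b + 2 * ln (ln g) - 2 * ln g.
    rewrite !mulr_natl -!lnXn// -lnM ?posrE ?exprn_gt0// -ln_div ?posrE//.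
    by rewrite ler_ln ?posrE// divr_gt0.
  rewrite ler_pdivrMr// ler_pdivlMr//.
  have ln0 := lt0r_neq0 l0.
  have -> : (2 - ln b / ln g - 2 * (ln (ln g) / ln g)) * ln g =
    2 * ln g - ln b - 2 * ln (ln g) by field.
  have -> : (2 - ln a / ln g) * ln g = 2 * ln g - ln a by field.
  by apply/andP; split; lra.
- rewrite -[X in _ --> X]subr0 -[X in _ --> X - _]subr0.
  apply: cvgB; first (apply: cvgB; first exact: cvg_cst).
  + by rewrite -[X in _ --> X](mulr0 (ln b)); apply: cvgM; [exact: cvg_cst|exact: cvgy_invr_ln].
  + by rewrite -[X in _ --> X](mulr0 2); apply: cvgM; [exact: cvg_cst|exact: cvgy_lnln_div].
- rewrite -[X in _ --> X]subr0; apply: cvgB; first exact: cvg_cst.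
  by rewrite -[X in _ --> X](mulr0 (ln a)); apply: cvgM; [exact: cvg_cst|exact: cvgy_invr_ln].
Unshelve. all: by end_near. Qed.

End Asymptotics.

(** * Rayleigh and Gaussian estimates *)

Section Laws.
Local Open Scope classical_set_scope.
Variable R : realType.
Notation mu := (@lebesgue_measure R).

Lemma lebesgue_measure_itvcc (a b : R) : a <= b -> mu `[a, b] = (b - a)%:E.
Proof.
move=> ab; rewrite lebesgue_measure_itv/= lte_fin; case: ltP => // ba.
by rewrite (le_anti (_ : a <= b <= a)) ?ab// subrr.
Qed.

Lemma integral_itv_le (f : R -> R) (a b M : R) : a <= b ->
  measurable_fun setT f -> (forall x, 0 <= f x) ->
  (forall x, a <= x <= b -> f x <= M) ->
  (\int[mu]_(x in `[a, b]) (f x)%:E <= ((b - a) * M)%:E)%E.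
Proof.
move=> ab mf f0 fM.
apply: (@le_trans _ _ (\int[mu]_(x in `[a, b]) (cst M%:E x))%E).
  apply: ge0_le_integral => //=.
  - by move=> x _; rewrite lee_fin.
  - by apply/measurable_EFinP; apply: measurable_funTS.
by rewrite integral_cst//= lebesgue_measure_itvcc// -EFinM mulrC.
Qed.

Lemma integral_itv_ge (f : R -> R) (a b M : R) : a <= b -> 0 <= M ->
  measurable_fun setT f ->
  (forall x, a <= x <= b -> M <= f x) ->
  (((b - a) * M)%:E <= \int[mu]_(x in `[a, b]) (f x)%:E)%E.
Proof.
move=> ab M0 mf fM.
apply: (@le_trans _ _ (\int[mu]_(x in `[a, b]) (cst M%:E x))%E).
  by rewrite integral_cst//= lebesgue_measure_itvcc// -EFinM mulrC.
apply: ge0_le_integral => //=.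
- by apply/measurable_EFinP; apply: measurable_funTS.
Qed.

Lemma measurable_rayleigh_pdf (s : R) : measurable_fun setT (rayleigh_pdf s).
Proof.
apply: measurable_fun_ifT => //=; first exact: measurable_fun_ler.
apply: measurable_funM; first exact: measurable_funM.
apply: measurableT_comp => //; apply: measurableT_comp => //.
by apply: measurable_funM => //; exact: measurable_funX.
Qed.

Lemma rayleigh_pdf_ge0 (s x : R) : 0 <= rayleigh_pdf s x.
Proof.
rewrite /rayleigh_pdf; case: ifP => // x0.
by rewrite mulr_ge0 ?expR_ge0// divr_ge0// sqr_ge0.
Qed.

(** Bounds the exponential by 1 and [x] by [t]. Only the order [t ^+ 2] matters later, so the
    constant lost against the exact integral is harmless. *)
Lemma rayleigh_itv_le (s t : R) : 0 <= t ->
  (\int[mu]_(x in `[0%R, t]) (rayleigh_pdf s x)%:E <= (t ^+ 2 / s ^+ 2)%:E)%E.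
Proof.
move=> t0; have -> : t ^+ 2 / s ^+ 2 = (t - 0) * (t / s ^+ 2).
  by rewrite subr0 expr2 mulrA.
apply: integral_itv_le => //; [exact: measurable_rayleigh_pdf|exact: rayleigh_pdf_ge0|].
move=> x /andP[x0 xt]; rewrite /rayleigh_pdf x0.
apply: (@le_trans _ _ (x / s ^+ 2)).
  rewrite ler_piMr ?divr_ge0 ?sqr_ge0//.
  by rewrite -expR0 ler_expR oppr_le0 divr_ge0 ?sqr_ge0// mulr_ge0 ?sqr_ge0.
by rewrite ler_wpM2r// invr_ge0 sqr_ge0.
Qed.

(** The density vanishes at 0, so only the upper half of the interval is kept: there [x >= t / 2],
    and [t <= 1] bounds the exponential from below. *)
Lemma rayleigh_itv_ge (s t : R) : 0 < s -> 0 <= t <= 1 ->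
  ((t ^+ 2 * (expR (- (2 * s ^+ 2)^-1) / (4 * s ^+ 2)))%:E <=
   \int[mu]_(x in `[0%R, t]) (rayleigh_pdf s x)%:E)%E.
Proof.
move=> s0 /andP[t0 t1].
have t2 : t / 2 <= t by lra.
have th0 : 0 <= t / 2 by lra.
apply: (@le_trans _ _ (\int[mu]_(x in `[(t / 2)%R, t]) (rayleigh_pdf s x)%:E)%E);
    last first.
  apply: ge0_subset_integral => //=.
  - by apply/measurable_EFinP; apply: measurable_funTS; exact: measurable_rayleigh_pdf.
  - by move=> x _; rewrite lee_fin rayleigh_pdf_ge0.
  - by apply: subset_itvr; rewrite bnd_simp.
have -> : t ^+ 2 * (expR (- (2 * s ^+ 2)^-1) / (4 * s ^+ 2)) =
    (t - t / 2) * ((t / 2) / s ^+ 2 * expR (- (2 * s ^+ 2)^-1)).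
  by field; rewrite gt_eqF.
apply: integral_itv_ge => //.
- by rewrite mulr_ge0 ?expR_ge0// divr_ge0// sqr_ge0.
- exact: measurable_rayleigh_pdf.
move=> x /andP[tx xt]; have x0 : 0 <= x by apply: le_trans tx.
rewrite /rayleigh_pdf x0 ler_pM ?expR_ge0//.
- by rewrite divr_ge0// sqr_ge0.
- by rewrite ler_wpM2r// invr_ge0 sqr_ge0.
rewrite ler_expR lerN2 ler_piMl ?invr_ge0 ?mulr_ge0 ?(ltW s0)//.
by rewrite expr_le1//; exact: le_trans xt t1.
Qed.

(** The density decreases with [|x|], so its value at [M] is the height of a rectangle lying below
    it on the interval. *)
Lemma normal_prob_itv_ge (a b M sigma : R) : 0 < sigma -> a <= b ->
  (forall x, a <= x <= b -> `|x| <= M) ->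
  (((b - a) * (normal_peak sigma * expR (- (M ^+ 2 / (2 * sigma ^+ 2)))))%:E <=
   normal_prob 0 sigma `[a, b])%E.
Proof.
move=> s0 ab xM; have s1 := lt0r_neq0 s0.
apply: integral_itv_ge => //.
- by rewrite mulr_ge0 ?expR_ge0 ?normal_peak_ge0.
- exact: measurable_normal_pdf.
move=> x /xM xM'; rewrite normal_pdfE// ler_wpM2l ?normal_peak_ge0//.
rewrite /normal_fun ler_expR subr0 mulNr lerN2 -[X in _ / X <= _]mulr_natl.
rewrite ler_wpM2r ?invr_ge0 ?mulr_ge0 ?(ltW s0)//.
by rewrite -[leLHS]real_normK ?num_real// lerXn2r ?nnegrE//; exact: le_trans xM'.
Qed.

(** Doubling the variance divides the peak by [Num.sqrt 2]; this is the source of that factor in the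
    tail bound. *)
Lemma normal_peak_scale (sigma : R) :
  normal_peak sigma = Num.sqrt 2 * normal_peak (Num.sqrt 2 * sigma).
Proof.
rewrite /normal_peak exprMn sqr_sqrtr// -[in RHS]mulrA -[in RHS]mulrnAr [in RHS]sqrtrM// invfM.
by rewrite mulrA divff ?mul1r// gt_eqF// sqrtr_gt0.
Qed.

(* Half of the exponent controls the tail; the other half is the density of a
   Gaussian of twice the variance. *)
Lemma normal_prob_tail_le (t sigma : R) : 0 < sigma -> 0 <= t ->
  (normal_prob 0 sigma [set x | (t <= `|x|)%R] <=
   (Num.sqrt 2 * expR (- (t ^+ 2 / (4 * sigma ^+ 2))))%:E)%E.
Proof.
move=> s0 t0; have s1 := lt0r_neq0 s0.
pose sigma' := Num.sqrt 2 * sigma.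
have s1' : sigma' != 0 by rewrite mulf_neq0// gt_eqF// sqrtr_gt0.
set C := _ * expR _.
have C0 : 0 <= C by rewrite mulr_ge0 ?sqrtr_ge0 ?expR_ge0.
have mt : measurable [set x : R | t <= `|x|].
  by rewrite -[X in measurable X]setTI; apply: measurable_fun_ler => //; exact: measurableT_comp.
have mpdf u : measurable_fun setT (EFin \o normal_pdf 0 u : R -> \bar R).
  by apply/measurable_EFinP; exact: measurable_normal_pdf.
apply: (@le_trans _ _
  (\int[mu]_(x in [set x | (t <= `|x|)%R]) (C%:E * (normal_pdf 0 sigma' x)%:E))%E).
  apply: ge0_le_integral => //=.
  - by move=> x _; rewrite lee_fin normal_pdf_ge0.
  - by apply: measurable_funTS; exact: mpdf.
  - by apply: measurable_funTS; apply: measurable_funeM; exact: mpdf.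
  move=> x tx; rewrite lee_fin !normal_pdfE// normal_peak_scale -/sigma' /C.
  rewrite -[leRHS]mulrA -[leLHS]mulrA ler_wpM2l ?sqrtr_ge0//.
  rewrite [leRHS]mulrCA ler_wpM2l ?normal_peak_ge0//.
  rewrite /normal_fun -expRD ler_expR !subr0 /sigma' exprMn sqr_sqrtr//.
  have tx2 : t ^+ 2 <= x ^+ 2.
    by rewrite -[leRHS]real_normK ?num_real// lerXn2r ?nnegrE.
  have -> : - x ^+ 2 / (sigma ^+ 2 *+ 2) =
    - (x ^+ 2 / (4 * sigma ^+ 2)) + - x ^+ 2 / (2 * sigma ^+ 2 *+ 2).
    by field; rewrite s1.
  rewrite lerD2r lerN2.
  by rewrite ler_wpM2r// invr_ge0 !mulr_ge0 ?(ltW s0).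
rewrite ge0_integralZl//=.
- rewrite -[leRHS]mule1 lee_wpmul2l ?lee_fin//.
  rewrite -(integral_normal_pdf 0 sigma'); apply: ge0_subset_integral => //=.
    exact: mpdf.
  by move=> x _; rewrite lee_fin normal_pdf_ge0.
- by apply: measurable_funTS; exact: mpdf.
- by move=> x _; rewrite lee_fin normal_pdf_ge0.
Qed.

End Laws.

(** * Error probability over the channel *)

Section FiniteValued.
Local Open Scope classical_set_scope.
Context d (T : measurableType d).

Lemma measurable_preimage_finType (K : finType) (f : T -> K) (B : set K) :
  (forall k, measurable (f @^-1` [set k])) -> measurable (f @^-1` B).
Proof.
move=> mf; rewrite (_ : f @^-1` B = \bigcup_(k in B) f @^-1` [set k]).
  by apply: fin_bigcup_measurable.
by apply/seteqP; split => [t Bt|t [k Bk] /= ->//]; exists (f t).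
Qed.

(** Since [B] is arbitrary, the decoder can be treated as a black box fed with finitely many
    measurable tests, including its tie-breaking by choice. *)
Lemma measurable_preimage_ffun (I : finType) (f : T -> {ffun I -> bool})
    (B : set {ffun I -> bool}) :
  (forall i, measurable_fun setT (fun t => f t i)) -> measurable (f @^-1` B).
Proof.
move=> mf; apply: measurable_preimage_finType => k.
rewrite (_ : _ @^-1` _ = \bigcap_(i in [set: I]) ((fun t => f t i) @^-1` [set k i])).
  apply: fin_bigcap_measurable => // i _.
  by rewrite -[X in measurable X]setTI; exact: mf.
apply/seteqP; split => [t /= ftk i _|t /= H]; first by rewrite /= ftk.
by apply/ffunP => i; exact: (H i).
Qed.

End FiniteValued.

(** * Error bounds at a fixed noise variance *)

Section Channel.
Local Open Scope classical_set_scope.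
Context d (T : measurableType d) (R : realType) (P : probability T R).
Variables (n : nat) (s N0 : R) (h : 'I_n -> {RV P >-> R}) (w : 'I_n -> T -> R[i]).
Hypotheses (s_gt0 : 0 < s) (N0_gt0 : 0 < N0) (ch : rayleigh_channel s N0 h w).
Let sigma := Num.sqrt (N0 / 2).

Let sigma_gt0 : 0 < sigma. Proof. by rewrite sqrtr_gt0 divr_gt0. Qed.

Let re i (t : T) : R := complex.Re (w i t).

Lemma measurable_noise_re i : measurable_fun setT (re i).
Proof.
have [mw _] := noise_law ch i.
exact: (measurableT_comp (@measurable_fst _ _ R R) mw).
Qed.

Lemma fading_prob i A : measurable A -> P (h i @^-1` A) =
  (\int[lebesgue_measure]_(x in A) (rayleigh_pdf s x)%:E)%E.
Proof. exact: (fading_law ch). Qed.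

(** The real part is the first marginal of the product law: the cylinder over [A] has a second
    factor of mass 1. *)
Lemma noise_re_prob i A : measurable A -> P (re i @^-1` A) = normal_prob 0 sigma A.
Proof.
move=> mA; have [_ lw] := noise_law ch i.
have -> : re i @^-1` A = real_pair (w i) @^-1` (A `*` setT).
  by apply/seteqP; split => [t|t []].
rewrite lw; last exact: measurableX.
by rewrite product_measure1E// [X in (_ * X)%E]integral_normal_pdf mule1.
Qed.

Definition channel_event (A B : 'I_n -> set R) (k : 'I_n + 'I_n) : set T :=
  match k with inl i => h i @^-1` A i | inr i => re i @^-1` B i end.

(** An event on the real part of the noise is a cylinder event of the complex variable, hence
    covered by the independence of the channel. The set [J] selects the constraints that count, so
    this one formula serves both products below. *)
Lemma channel_eventP (A B : 'I_n -> set R) (J : {set 'I_n + 'I_n}) :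
  (forall i, measurable (A i)) -> (forall i, measurable (B i)) ->
  P (\bigcap_(k in [set` J]) channel_event A B k) =
  (\prod_(k in J) P (channel_event A B k))%E.
Proof.
move=> mA mB; apply: (channel_independent ch) => -[i|i] _.
  by exists (A i) => //; rewrite setTI.
exists (B i `*` setT); first exact: measurableX.
by rewrite setTI; apply/seteqP; split => [t []|t].
Qed.

Lemma fading_pair_prob i j A : i != j -> measurable A ->
  P (h i @^-1` A `&` h j @^-1` A) = (P (h i @^-1` A) * P (h j @^-1` A))%E.
Proof.
move=> ij mA.
have := @channel_eventP (fun=> A) (fun=> setT) [set inl i; inl j]%SET
  (fun=> mA) (fun=> measurableT).
rewrite big_setU1/= ?big_set1/=; last by rewrite inE.
move=> <-; congr (P _); apply/seteqP; split => t /=.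
  by move=> [hi hj] k; rewrite /= !inE => /orP[]/eqP ->.
by move=> H; split; [apply: (H (inl i))|apply: (H (inl j))]; rewrite /= !inE eqxx ?orbT.
Qed.

Lemma fading_noise_pair_prob i j A (B : 'I_n -> set R) : i != j ->
  measurable A -> (forall k, measurable (B k)) ->
  P (\bigcap_(k in [set` [set i; j]%SET]) (h k @^-1` A `&` re k @^-1` B k)) =
  ((P (h i @^-1` A) * P (re i @^-1` B i)) *
   (P (h j @^-1` A) * P (re j @^-1` B j)))%E.
Proof.
move=> ij mA mB.
have := @channel_eventP (fun=> A) B
  [set inl i; inr i; inl j; inr j]%SET (fun=> mA) mB.
rewrite -!finset.setUA !big_setU1/= ?big_set1/=; last first.
- by rewrite !inE /= !/(_ == _)/= (negbTE ij).
- by rewrite !inE /= !/(_ == _)/= (negbTE ij).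
- by rewrite !inE.
rewrite muleA => <-; congr (P _); apply/seteqP; split => t /= H.
  move=> l; case: l => k kij; have [] := H k; move: kij;
    by rewrite //= !inE ?orbF.
move=> k; rewrite /= !inE => /orP[]/eqP ->; split.
- by apply: (H (inl i)); rewrite /= !inE eqxx ?orbT.
- by apply: (H (inr i)); rewrite /= !inE eqxx ?orbT.
- by apply: (H (inl j)); rewrite /= !inE eqxx ?orbT.
- by apply: (H (inr j)); rewrite /= !inE eqxx ?orbT.
Qed.

Variable c : 'rV['F_2]_n.
Let error := [set t | flip_decoder (fun i => h i t)
  (received (fun i => h i t) (fun i => w i t) c) <> c].

Lemma measurable_flip_error : measurable error.
Proof.
(* The decoder depends only on the decision signs and on the pairwise comparisons of fading
   magnitudes. [f] records these booleans; [bits], [low] and [out] replay the decoder on them. *)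
pose f t : {ffun 'I_n + 'I_n * 'I_n -> bool} := [ffun k => match k with
  | inl i => 0 < h i t * bpsk R (c 0 i) + re i t
  | inr (i, j) => `|h i t| <= `|h j t| end].
pose bits (k : {ffun 'I_n + 'I_n * 'I_n -> bool}) : 'rV['F_2]_n :=
  \row_i (if k (inl i) then 1 else 0).
pose low (k : {ffun 'I_n + 'I_n * 'I_n -> bool}) :=
  [pick i | [forall j, k (inr (i, j))]].
pose out k : 'rV['F_2]_n := if parity_check_fails (bits k) then
  \row_i (if low k == Some i then 1 - bits k 0 i else bits k 0 i) else bits k.
rewrite (_ : error = f @^-1` [set k | out k <> c]).
  apply: measurable_preimage_ffun => -[i|[i j]].
    under eq_fun do rewrite ffunE.
    apply: measurable_fun_ltr => //; apply: measurable_funD.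
      exact: measurable_funM.
    exact: measurable_noise_re.
  under eq_fun do rewrite ffunE.
  by apply: measurable_fun_ler; exact: measurableT_comp.
suff outE t : flip_decoder (fun i => h i t)
  (received (fun i => h i t) (fun i => w i t) c) = out (f t).
  by apply/seteqP; split => t; rewrite /error /preimage /= outE.
rewrite /flip_decoder /out.
have -> : hard_decision (received (fun i => h i t) (fun i => w i t) c) = bits (f t).
  apply/rowP => i; rewrite !mxE ffunE /received.
  by rewrite [complex.Re (_ + _)]raddfD.
have -> // : weakest (fun i => h i t) = low (f t).
by apply: eq_pick => i; apply: eq_forallb => j; rewrite ffunE.
Qed.

(** Union bound over the ordered pairs of positions: each pair costs one Gaussian tail plus the
    probability that two independent fading coefficients are both at most [tau]. *)
Lemma flip_error_prob_le (tau : R) : c \in parity_code n -> 0 <= tau ->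
  (P error <= ((n * n)%:R * (Num.sqrt 2 * expR (- (tau ^+ 2 / (4 * sigma ^+ 2)))
                             + (tau ^+ 2 / s ^+ 2) ^+ 2))%:E)%E.
Proof.
move=> cC tau0; set bd := (_ + _)%R.
pose N i := [set t | tau <= `|re i t|].
pose F i := h i @^-1` `[0, tau].
(* The fading part is emptied on the diagonal, because the product formula requires distinct
   positions. *)
pose E (p : 'I_n * 'I_n) := N p.1 `|` (if p.1 == p.2 then set0 else F p.1 `&` F p.2).
have mset : measurable [set x : R | tau <= `|x|].
  by rewrite -[X in measurable X]setTI; apply: measurable_fun_ler => //; exact: measurableT_comp.
have mN i : measurable (N i).
  by rewrite -[X in measurable X]setTI; exact: (measurable_noise_re i measurableT mset).
have mF i : measurable (F i).
  by rewrite -[X in measurable X]setTI; apply: measurable_funP.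
have mF2 (p : 'I_n * 'I_n) : measurable (if p.1 == p.2 then set0 else F p.1 `&` F p.2).
  by case: ifP => // _; exact: measurableI.
have mE p : measurable (E p) by apply: measurableU.
have PE p : (P (E p) <= bd%:E)%E.
  apply: (le_trans (measureU2 _ _ _)) => //; rewrite EFinD leeD//.
    by rewrite [X in (X <= _)%E](noise_re_prob p.1 mset); exact: normal_prob_tail_le.
  case: ifPn => [_|ij]; first by rewrite measure0 lee_fin sqr_ge0.
  rewrite [X in (X <= _)%E](fading_pair_prob ij (measurable_itv _)) !fading_prob// expr2 EFinM.
  by apply: lee_pmul; rewrite ?rayleigh_itv_le//; apply: integral_ge0 => x _;
    rewrite lee_fin rayleigh_pdf_ge0.
apply: (@le_trans _ _ (\sum_(p \in [set: 'I_n * 'I_n]) P (E p))%E).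
  apply: content_sub_fsum => //; [exact: finite_finset|exact: measurable_flip_error|].
  move=> t /(flip_decoder_neq_sub cC)[i [j [ij bi bj]]].
  have hi := hard_decision_neq_le bi.
  have [tw|tw] := leP tau `|re i t|; first by exists (i, j) => //; left.
  have hit : h i t <= tau by apply: le_trans hi _; exact: ltW.
  have hi0 k : 0 <= h k t := fading_ge0 ch k t.
  have [hj|hj] := leP (h j t) tau.
    exists (i, j) => //; right; rewrite /= (negbTE ij).
    by split; rewrite /F /preimage/= in_itv/= ?hi0.
  (* Here [h i t <= tau < h j t], which rules out the comparison of magnitudes. So decision [j] is
     wrong too, and its noise exceeds [tau]: the swapped pair [(j, i)] covers [t]. *)
  case: bj => [/hard_decision_neq_le bj|]; last first.
    by rewrite !ger0_norm// => /(lt_le_trans hj); rewrite ltNge hit.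
  by exists (j, i) => //; left; rewrite /N/=; apply: le_trans bj; exact: ltW.
rewrite (fsbigE (index_enum _)) ?index_enum_uniq//; last first.
  by move=> p _; rewrite mem_index_enum.
apply: (@le_trans _ _ (\sum_(p : 'I_n * 'I_n) bd%:E)%E).
  by rewrite big_mkcond/=; apply: lee_sum => p _; rewrite in_setT.
by rewrite sumEFin sumr_const card_prod card_ord mulr_natl.
Qed.

(** Two fixed positions are made wrong by fading at most [dl] against adverse noise of at least
    [2 * dl]; independence then gives the square of the bound for a single position. *)
Lemma flip_error_prob_ge (dl : R) : (2 <= n)%N -> 0 < dl <= 1 ->
  (((dl ^+ 2 * (expR (- (2 * s ^+ 2)^-1) / (4 * s ^+ 2)) *
    (dl * (normal_peak sigma * expR (- ((3 * dl) ^+ 2 / (2 * sigma ^+ 2)))))) ^+ 2)%:E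
   <= P error)%E.
Proof.
move=> n2 /andP[dl0 dl1].
pose i : 'I_n := Ordinal (ltnW n2); pose j : 'I_n := Ordinal n2.
have ij : i != j by [].
(* Bit 0 is sent as -1, so positive noise is adverse to it. The end [2 * dl] beats the fading
   strictly, while [3 * dl] keeps the Gaussian density bounded below. *)
pose B (k : 'I_n) : set R :=
  if c 0 k == 0 then `[2 * dl, 3 * dl] else `[- (3 * dl), - (2 * dl)].
have mB k : measurable (B k) by rewrite /B; case: ifP.
have PB k : ((dl * (normal_peak sigma * expR (- ((3 * dl) ^+ 2 / (2 * sigma ^+ 2)))))%:E
   <= P (re k @^-1` B k))%E.
  rewrite noise_re_prob// /B; case: ifP => _.
    rewrite [X in (X * _)%:E](_ : _ = 3 * dl - 2 * dl); last by ring.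
    apply: normal_prob_itv_ge => //; first by lra.
    by move=> x /andP[? ?]; rewrite ler_norml; apply/andP; split; lra.
  rewrite [X in (X * _)%:E](_ : _ = - (2 * dl) - - (3 * dl)); last by ring.
  apply: normal_prob_itv_ge => //; first by lra.
  by move=> x /andP[? ?]; rewrite ler_norml; apply/andP; split; lra.
have PA k : ((dl ^+ 2 * (expR (- (2 * s ^+ 2)^-1) / (4 * s ^+ 2)))%:E <=
    P (h k @^-1` `[0%R, dl]))%E.
  by rewrite fading_prob//; apply: rayleigh_itv_ge => //; rewrite ltW.
set a := _ * (_ / _) in PA *; set b := dl * (_ * _) in PB *.
have a0 : 0 <= a.
  by rewrite !mulr_ge0 ?expR_ge0 ?invr_ge0 ?mulr_ge0 ?(ltW s_gt0) ?(ltW dl0).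
have b0 : 0 <= b by rewrite !mulr_ge0 ?expR_ge0 ?normal_peak_ge0 ?(ltW dl0).
clearbody a b.
pose G := \bigcap_(k in [set` [set i; j]%SET])
  (h k @^-1` `[0, dl] `&` re k @^-1` B k).
apply: (@le_trans _ _ (P G)).
  rewrite fading_noise_pair_prob// expr2 !EFinM.
  by apply: lee_pmul; rewrite ?mule_ge0 ?lee_fin//; apply: lee_pmul; rewrite ?lee_fin.
have mre k : measurable (re k @^-1` B k).
  by rewrite -[X in measurable X]setTI; exact: (measurable_noise_re k measurableT (mB k)).
apply: le_measure; rewrite ?inE.
- apply: fin_bigcap_measurable => // k _; apply: measurableI => //.
  by rewrite -[X in measurable X]setTI; apply: measurable_funP.
- exact: measurable_flip_error.
move=> t Gt; have bad k : k \in [set i; j]%SET -> hard_decision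
    (received (fun i => h i t) (fun i => w i t) c) 0 k != c 0 k.
  move=> /Gt[]; rewrite /preimage/= in_itv/= => /andP[_ hk].
  rewrite /B => Bk; apply: hard_decision_neq; move: Bk.
  rewrite -/(re k t) /bpsk; case: (c 0 k) => [[|[|//]] ?] /=; rewrite in_itv/= => /andP[].
    by rewrite mulr0; lra.
  by lra.
by apply: (flip_decoder_neq ij); apply: bad; rewrite !inE eqxx ?orbT.
Qed.

End Channel.

(** * Error bounds as functions of the SNR, and the diversity order *)

Lemma flip_error_probability_ge d (T : measurableType d) (R : realType)
    (P : probability T R) n (s g : R) (h : 'I_n -> {RV P >-> R})
    (w : 'I_n -> T -> R[i]) (c : 'rV['F_2]_n) :
  (2 <= n)%N -> 0 < s -> 1 <= g -> rayleigh_channel s g^-1 h w ->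
  (expR (- (2 * s ^+ 2)^-1) / (4 * s ^+ 2) * (expR (- 9) / Num.sqrt pi)) ^+ 2 / g ^+ 2
    <= flip_error_probability h w c.
Proof.
move=> n2 s0 g1 ch; have g0 : 0 < g by apply: lt_le_trans g1.
have gV0 : 0 < g^-1 by rewrite invr_gt0.
(* This matches the noise scale: the real part has variance [g^-1 / 2], so the noise factor becomes
   the constant [expR (- 9) / Num.sqrt pi] and only the two fading factors, each of order [g^-1],
   depend on the SNR. *)
set dl := Num.sqrt g^-1.
have dl0 : 0 < dl by rewrite sqrtr_gt0.
have dl2 : dl ^+ 2 = g^-1 by rewrite sqr_sqrtr ?ltW.
have dl1 : dl <= 1 by rewrite -sqrtr1 ler_sqrt// invf_le1.
have := flip_error_prob_ge s0 gV0 ch c n2 (_ : 0 < dl <= 1).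
rewrite dl0 dl1 => /(_ isT).
have sE : Num.sqrt (g^-1 / 2) ^+ 2 = g^-1 / 2 by rewrite sqr_sqrtr// divr_ge0 ?ltW.
have -> : dl * (normal_peak (Num.sqrt (g^-1 / 2)) *
    expR (- ((3 * dl) ^+ 2 / (2 * Num.sqrt (g^-1 / 2) ^+ 2)))) =
    expR (- 9) / Num.sqrt pi.
  rewrite exprMn dl2 sE.
  have -> : 3 ^+ 2 * g^-1 / (2 * (g^-1 / 2)) = 9 by field; rewrite gt_eqF.
  rewrite mulrA mulrC; congr (_ * _).
  rewrite /normal_peak sE (_ : g^-1 / 2 * pi *+ 2 = g^-1 * pi); last first.
    by field; rewrite gt_eqF.
  by rewrite sqrtrM ?(ltW gV0)// invfM mulrA divff ?mul1r// gt_eqF.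
rewrite dl2 -mulrA exprMn exprVn mulrC => H.
rewrite -lee_fin fineK//.
by rewrite fin_num_measure//; exact: (measurable_flip_error ch).
Qed.

Lemma flip_error_probability_le d (T : measurableType d) (R : realType)
    (P : probability T R) n (s g : R) (h : 'I_n -> {RV P >-> R})
    (w : 'I_n -> T -> R[i]) (c : 'rV['F_2]_n) :
  c \in parity_code n -> 0 < s -> 0 < g -> 1 <= ln g ->
  rayleigh_channel s g^-1 h w ->
  flip_error_probability h w c <=
    (n * n)%:R * (Num.sqrt 2 + 16 / s ^+ 4) * ln g ^+ 2 / g ^+ 2.
Proof.
move=> cC s0 g0 l1 ch.
have l0 : 0 <= ln g by apply: le_trans l1.
have gV0 : 0 < g^-1 by rewrite invr_gt0.
(* Chosen so that the Gaussian exponent, [tau ^+ 2] over [2 / g], equals [2 * ln g], which makes the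
   tail of order [g ^- 2]. *)
set tau := Num.sqrt (4 * ln g / g).
have tau2 : tau ^+ 2 = 4 * ln g / g by rewrite sqr_sqrtr// divr_ge0 ?mulr_ge0 ?(ltW g0).
have := flip_error_prob_le gV0 ch cC (_ : 0 <= tau).
rewrite sqrtr_ge0 => /(_ isT).
rewrite tau2 sqr_sqrtr ?divr_ge0 ?(ltW gV0)//.
have -> : 4 * ln g / g / (4 * (g^-1 / 2)) = ln (g ^+ 2).
  by rewrite lnXn// -mulr_natl; field; rewrite gt_eqF.
rewrite expRN lnK ?posrE ?exprn_gt0// => H.
rewrite -lee_fin fineK; last first.
  by rewrite fin_num_measure//; exact: (measurable_flip_error ch).
apply: (le_trans H); rewrite lee_fin -[leRHS]mulrA -[leRHS]mulrA ler_wpM2l//.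
have -> : (4 * ln g / g / s ^+ 2) ^+ 2 =
    16 / s ^+ 4 * (ln g ^+ 2 / g ^+ 2) by field; rewrite !gt_eqF.
(* The Gaussian term has no logarithm; it is absorbed into the common shape by [1 <= ln g]. *)
rewrite [leRHS]mulrDl lerD2r ler_wpM2l ?sqrtr_ge0// ler_peMl ?invr_ge0 ?sqr_ge0//.
by rewrite exprn_ege1.
Qed.

Unset Implicit Arguments.

Theorem theorem1 (R : realType) (n : nat) (n_ge2 : (2 <= n)%N)
    (d : R -> measure_display) (T : forall snr : R, measurableType (d snr))
    (P : forall snr : R, probability (T snr) R)
    (s : R) (s_gt0 : 0 < s)
    (h : forall snr : R, 'I_n -> {RV (P snr) >-> R})
    (w : forall snr : R, 'I_n -> T snr -> R[i])
    (channel : forall snr : R, 0 < snr ->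
       rayleigh_channel s snr^-1 (h snr) (w snr))
    (c : 'rV['F_2]_n) (cC : c \in parity_code n) :
  [/\ \dim (parity_code n) = n.-1,
      min_distance (parity_code n) = 2%N &
      has_diversity_order
        (fun snr : R => flip_error_probability (h snr) (w snr) c)
        (min_distance (parity_code n))%:R].
Proof.
rewrite min_distance_parity_code//; split => //.
  by rewrite dim_parity_code// ltnW.
(* Both constants are independent of the SNR and of the probability space, which may change with it;
   this is what allows the squeeze in the limit. *)
pose a : R := (expR (- (2 * s ^+ 2)^-1) / (4 * s ^+ 2) * (expR (- 9) / Num.sqrt pi)) ^+ 2.
pose b : R := (n * n)%:R * (Num.sqrt 2 + 16 / s ^+ 4).
apply: (@has_diversity_order2 R _ a b).
- by rewrite exprn_gt0// mulr_gt0// divr_gt0 ?expR_gt0 ?sqrtr_gt0 ?pi_gt0// mulr_gt0 ?exprn_gt0.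
- rewrite mulr_gt0 ?ltr0n ?muln_gt0 ?(ltnW n_ge2)//.
  by rewrite addr_gt0 ?sqrtr_gt0// divr_gt0// exprn_gt0.
near=> g.
have g1 : 1 <= g by near: g; exact: nbhs_pinfty_ge.
have g0 : 0 < g by apply: lt_le_trans g1.
have l1 : 1 <= ln g by near: g; move: (@cvgy_ln R) => /cvgryPge; exact.
apply/andP; split.
- exact: flip_error_probability_ge (channel g g0).
- exact: flip_error_probability_le (channel g g0).
Unshelve. all: by end_near. Qed.
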